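(* Every $M\in\mathcal{M}_{\mathfrak{sl}(1|1)}(2)$ has infinite length. More precisely: each submodule of $M\left(\begin{bmatrix}0&1\\0&0\end{bmatrix},\begin{bmatrix}0&0\\ h&0\end{bmatrix}\right)$ equals $J\oplus J$ or $J\oplus hJ$ for some ideal $J\subset\mathbb{C}[h]$; and each submodule of $M\left( \begin{bmatrix} 0 & h \\ 0 & 0 \end{bmatrix}, \begin{bmatrix} 0 & 0 \\ 1 & 0 \end{bmatrix} \right)$ equals $J\oplus J$ or $hJ\oplus J$ for some ideal $J\subset\mathbb{C}[h]$.
   Context: Everything is over $\mathbb{C}$. The Lie superalgebra $\mathfrak{sl}(1|1)$ has basis $x=e_{1\bar 1}$, $y=e_{\bar 1 1}$ (odd) and $h=e_{11}+e_{\bar 1\bar 1}$ (even); its Cartan subalgebra is $\mathfrak{h}=\mathbb{C}h$, and $\mathcal{U}(\mathfrak{h})=\mathbb{C}[h]$. In $\mathcal{U}(\mathfrak{sl}(1|1))$, viewed as an ungraded associative algebra, one has $x^2=y^2=0$, $xy+yx=h$, and $h$ is central. $\mathcal{M}_{\mathfrak{sl}(1|1)}(2)$ is the category of (not necessarily $\mathbb{Z}_2$-graded) $\mathcal{U}(\mathfrak{sl}(1|1))$-modules whose restriction to $\mathcal{U}(\mathfrak{h})$ is free of rank 2. For $P,Q\in \mathrm{Mat}_2(\mathbb{C}[h])$ with $P^2=Q^2=0$ and $PQ+QP=h I_2$, $M(P,Q)$ denotes $\mathbb{C}[h]^{\oplus 2}$ (column vectors) on which $h$ acts by multiplication, $x$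 acts by left multiplication by $P$, and $y$ by left multiplication by $Q$. For ideals $J,K\subset\mathbb{C}[h]$, $J\oplus K$ is the set of column vectors with first entry in $J$ and second entry in $K$. *)

(* Defs.v *)
From HB Require Import structures.
From mathcomp Require Import all_boot all_order all_algebra.
From mathcomp Require Import complex ring.
From mathcomp Require Import boolp classical_sets reals.

Set Implicit Arguments.
Unset Strict Implicit.
Unset Printing Implicit Defensive.

Import GRing.Theory.
Local Open Scope ring_scope.
Local Open Scope classical_set_scope.

Section Modules.
Variables (A : nzRingType) (M : lmodType A).

Definition is_submodule (N : set M) : Prop := GRing.submod_closed (mem N).

(* The length of M is the supremum of the n for which such a chain exists. *)
Definition has_chain (n : nat) : Prop :=
  exists N : nat -> set M,
    (forall i, (i <= n)%N -> is_submodule (N i)) /\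
    (forall i, (i < n)%N -> N i `<` N i.+1).

Definition finite_length : Prop :=
  exists l : nat, forall n, has_chain n -> (n <= l)%N.

Definition infinite_length : Prop := ~ finite_length.

Definition free_of_rank (n : nat) : Prop :=
  exists e : 'I_n -> M,
    forall m : M, exists! c : {ffun 'I_n -> A}, m = \sum_(i < n) c i *: e i.

End Modules.

(* MathComp's idealr_closed only covers proper ideals; here J may be all of A. *)
Definition is_ideal (A : comNzRingType) (J : set A) : Prop :=
  @is_submodule A A^o J.

Section RestrictionOfScalars.
Variables (A B : nzRingType) (phi : {rmorphism A -> B}) (M : lmodType B).

Definition restrict (_ : {rmorphism A -> B}) : Type := M.

HB.instance Definition _ := GRing.Zmodule.on (restrict phi).

Let rscale (a : A) (m : restrict phi) : restrict phi := phi a *: (m : M).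

Fact rscaleA a b m : rscale a (rscale b m) = rscale (a * b) m.
Proof. by rewrite /rscale scalerA rmorphM. Qed.
Fact rscale1 : left_id 1 rscale.
Proof. by move=> m; rewrite /rscale rmorph1 scale1r. Qed.
Fact rscaleDr : right_distributive rscale +%R.
Proof. by move=> a u v; rewrite /rscale scalerDr. Qed.
Fact rscaleDl m : {morph rscale^~ m : a b / a + b}.
Proof. by move=> a b; rewrite /rscale rmorphD scalerDl. Qed.

HB.instance Definition _ := GRing.Zmodule_isLmodule.Build A (restrict phi)
  rscaleA rscale1 rscaleDr rscaleDl.

End RestrictionOfScalars.

(* The enveloping algebra of sl(1|1), in the PBW basis 1, x, y, xy over F[h]:
   Env a b c d is a + b x + c y + d xy, with 'X in the role of h.  The product
   is the one forced by x^2 = y^2 = 0, yx = h - xy and the centrality of h;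
   Usl11_universal below is the universal property. *)
Record Usl11 (F : fieldType) :=
  Env { env1 : {poly F}; envx : {poly F}; envy : {poly F}; envxy : {poly F} }.

Section Enveloping.
Variable F : fieldType.
Local Notation U := (Usl11 F).
Implicit Types u v w : U.

Definition env_tuple u := (env1 u, envx u, envy u, envxy u).
Definition tuple_env (t : {poly F} * {poly F} * {poly F} * {poly F}) : U :=
  let: (a, b, c, d) := t in Env a b c d.
Fact env_tupleK : cancel env_tuple tuple_env. Proof. by case. Qed.
HB.instance Definition _ := Choice.copy U (can_type env_tupleK).

Lemma env_eq u v : env1 u = env1 v -> envx u = envx v -> envy u = envy v ->
  envxy u = envxy v -> u = v.
Proof. by case: u v => [a b c d] [a' b' c' d'] /= -> -> -> ->. Qed.

Definition env_zero : U := Env 0 0 0 0.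
Definition env_opp u : U := Env (- env1 u) (- envx u) (- envy u) (- envxy u).
Definition env_add u v : U :=
  Env (env1 u + env1 v) (envx u + envx v) (envy u + envy v)
      (envxy u + envxy v).

Fact env_addA : associative env_add.
Proof. by move=> u v w; apply: env_eq; rewrite /= addrA. Qed.
Fact env_addC : commutative env_add.
Proof. by move=> u v; apply: env_eq; rewrite /= addrC. Qed.
Fact env_add0 : left_id env_zero env_add.
Proof. by move=> u; apply: env_eq; rewrite /= add0r. Qed.
Fact env_addN : left_inverse env_zero env_opp env_add.
Proof. by move=> u; apply: env_eq; rewrite /= addNr. Qed.

HB.instance Definition _ :=
  GRing.isZmodule.Build U env_addA env_addC env_add0 env_addN.

Definition env_one : U := Env 1 0 0 0.
Definition env_mul u v : U :=
  let: Env a b c d := u in let: Env a' b' c' d' := v in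
  Env (a * a' + 'X * (c * b'))
      (a * b' + b * a' + 'X * (d * b'))
      (a * c' + c * a' + 'X * (c * d'))
      (a * d' + b * c' - c * b' + d * a' + 'X * (d * d')).

Fact env_mulA : associative env_mul.
Proof. by do 3!case=> ? ? ? ?; apply: env_eq => /=; ring. Qed.
Fact env_mul1r : left_id env_one env_mul.
Proof. by case=> ? ? ? ?; apply: env_eq => /=; ring. Qed.
Fact env_mulr1 : right_id env_one env_mul.
Proof. by case=> ? ? ? ?; apply: env_eq => /=; ring. Qed.
Fact env_mulDl : left_distributive env_mul +%R.
Proof. by do 3!case=> ? ? ? ?; apply: env_eq => /=; ring. Qed.
Fact env_mulDr : right_distributive env_mul +%R.
Proof. by do 3!case=> ? ? ? ?; apply: env_eq => /=; ring. Qed.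
Fact env_one_neq0 : env_one != 0.
Proof. by apply/eqP => /(congr1 (@env1 F)) /eqP /=; rewrite oner_eq0. Qed.

HB.instance Definition _ := GRing.Zmodule_isNzRing.Build U
  env_mulA env_mul1r env_mulr1 env_mulDl env_mulDr env_one_neq0.

Definition env_scale (k : F) u : U :=
  Env (k *: env1 u) (k *: envx u) (k *: envy u) (k *: envxy u).

Fact env_scaleA k l u : env_scale k (env_scale l u) = env_scale (k * l) u.
Proof. by apply: env_eq; rewrite /= scalerA. Qed.
Fact env_scale1 : left_id 1 env_scale.
Proof. by move=> u; apply: env_eq; rewrite /= scale1r. Qed.
Fact env_scaleDr : right_distributive env_scale +%R.
Proof. by move=> k u v; apply: env_eq; rewrite /= scalerDr. Qed.
Fact env_scaleDl u : {morph env_scale^~ u : k l / k + l}.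
Proof. by move=> k l; apply: env_eq; rewrite /= scalerDl. Qed.

HB.instance Definition _ := GRing.Zmodule_isLmodule.Build F U
  env_scaleA env_scale1 env_scaleDr env_scaleDl.

Fact env_scalerAl (k : F) u v : k *: (u * v) = (k *: u) * v.
Proof.
by case: u v => ? ? ? ? [? ? ? ?]; apply: env_eq; rewrite /= -!mul_polyC; ring.
Qed.
HB.instance Definition _ := GRing.Lmodule_isLalgebra.Build F U env_scalerAl.

Fact env_scalerAr (k : F) u v : k *: (u * v) = u * (k *: v).
Proof.
by case: u v => ? ? ? ? [? ? ? ?]; apply: env_eq; rewrite /= -!mul_polyC; ring.
Qed.
HB.instance Definition _ := GRing.Lalgebra_isAlgebra.Build F U env_scalerAr.

Definition sl_x : U := Env 0 1 0 0.
Definition sl_y : U := Env 0 0 1 0.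
Definition sl_h : U := Env 'X 0 0 0.

(* The inclusion of U(h) = F[h] into U(sl(1|1)). *)
Definition Uh (p : {poly F}) : U := Env p 0 0 0.

Fact Uh_is_zmod_morphism : zmod_morphism Uh.
Proof. by move=> p q; apply: env_eq; rewrite /= ?subr0. Qed.
Fact Uh_is_monoid_morphism : monoid_morphism Uh.
Proof. by split=> // p q; apply: env_eq => /=; ring. Qed.

HB.instance Definition _ :=
  GRing.isZmodMorphism.Build {poly F} U Uh Uh_is_zmod_morphism.
HB.instance Definition _ :=
  GRing.isMonoidMorphism.Build {poly F} U Uh Uh_is_monoid_morphism.

Lemma Uh_X : Uh 'X = sl_h. Proof. by []. Qed.

Lemma env_expand u : u = Uh (env1 u) + Uh (envx u) * sl_x + Uh (envy u) * sl_y
  + Uh (envxy u) * (sl_x * sl_y).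
Proof. by case: u => a b c d; apply: env_eq => /=; ring. Qed.

(* sl(1|1) inside gl(1|1) = 'M_2; the ordinals 0, 1 are the indices 1, \bar 1. *)
Definition sl11 (X : 'M[F]_2) : Prop := X 0 0 - X 1 1 = 0.

Definition homogeneous (p : bool) (X : 'M[F]_2) : Prop :=
  forall i j, (i != j) != p -> X i j = 0.

Definition sbracket (A : algType F) (p q : bool) (a b : A) : A :=
  a * b - (-1) ^+ (p && q) * (b * a).

Definition super_morphism (A : algType F) (rho : 'M[F]_2 -> A) : Prop :=
  forall p q X Y, sl11 X -> sl11 Y -> homogeneous p X -> homogeneous q Y ->
  rho (sbracket p q X Y) = sbracket p q (rho X) (rho Y).

Definition sl11_inj (X : 'M[F]_2) : U :=
  X 0 0 *: sl_h + X 0 1 *: sl_x + X 1 0 *: sl_y.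

Fact sl11_inj_is_linear : linear sl11_inj.
Proof.
by move=> k X Y; apply: env_eq => /=; rewrite !mxE ?scaler0 ?addr0 ?add0r;
  rewrite -!mul_polyC ?(polyCD, polyCM); ring.
Qed.
HB.instance Definition _ :=
  GRing.isLinear.Build F 'M[F]_2 U _ sl11_inj sl11_inj_is_linear.


Lemma sl11_injE X : sl11_inj X = Env (X 0 0 *: 'X) (X 0 1)%:P (X 1 0)%:P 0.
Proof.
by apply: env_eq; rewrite /= ?scaler0 ?addr0 ?add0r // -mul_polyC mulr1.
Qed.

Lemma sl11_inj_super : super_morphism sl11_inj.
Proof.
move=> p q X Y; rewrite /sl11 => /subr0_eq hX /subr0_eq hY X0 Y0.
have mxM (V W : 'M[F]_2) i j : (V * W) i j = V i 0 * W 0 j + V i 1 * W 1 j.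
  by rewrite -mulmxE !mxE !big_ord_recl big_ord0 addr0 (_ : lift _ _ = 1) //; apply: val_inj.
have mxB (V W : 'M[F]_2) i j : (V - W) i j = V i j - W i j by rewrite !mxE.
have mxD (V W : 'M[F]_2) i j : (V + W) i j = V i j + W i j by rewrite !mxE.
rewrite /sbracket !sl11_injE.
have par p' (V : 'M[F]_2) : homogeneous p' V ->
    if p' then V 0 0 = 0 else V 0 1 = 0 /\ V 1 0 = 0.
  by case: p' => V0; [apply: V0 | split; apply: V0].
move/par: X0; move/par: Y0.
case: p q => [] [] /=; rewrite ?expr0 ?expr1 ?mulN1r ?opprK ?mul1r;
  do 2!match goal with
       | |- _ /\ _ -> _ => case=> ? ?
       | |- _ -> _ => move=> ?
       end;
  apply: env_eq; rewrite /= ?(mxB, mxD) ?mxM -?hX -?hY;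
  do 4?match goal with H : _ = 0 |- _ => rewrite ?H; clear H end;
  rewrite -?mul_polyC ?(polyCD, polyCM, polyCN, polyC0); ring.
Qed.

Section Lift.
Variables (A : nzRingType) (e : {poly F} -> A) (a b : A).

Definition env_lift u : A :=
  e (env1 u) + e (envx u) * a + e (envy u) * b + e (envxy u) * (a * b).

End Lift.

Section LiftMorphism.
Variables (A : nzRingType) (e : {rmorphism {poly F} -> A}) (a b : A).
Hypothesis aa : a * a = 0.
Hypothesis bb : b * b = 0.
Hypothesis ab : a * b + b * a = e 'X.
Hypothesis ea : forall p, a * e p = e p * a.
Hypothesis eb : forall p, b * e p = e p * b.

Let lift := env_lift e a b.

Lemma env_liftD : {morph lift : u v / u + v}.
Proof.
move=> u v; rewrite /lift /env_lift /= !rmorphD !mulrDl.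
by rewrite (AC (2*2*2*2) (1*3*5*7*(2*4*6*8))).
Qed.

Lemma env_lift1 : lift 1 = 1.
Proof. by rewrite /lift /env_lift /= rmorph1 rmorph0 !mul0r !addr0. Qed.

Let liftU p v : lift (Uh p * v) = e p * lift v.
Proof.
case: v => c d f g; rewrite /lift /env_lift /= !mul0r !mulr0 !addr0 subr0.
by rewrite !rmorphM !mulrDr !mulrA.
Qed.

Let liftx v : lift (sl_x * v) = a * lift v.
Proof.
case: v => c d f g; rewrite /lift /env_lift /=.
rewrite !(mul0r, mulr0, mul1r, addr0, add0r, subr0) rmorph0 !mulrDr.
rewrite ea !mulrA ea -(mulrA _ a a) aa mulr0 !ea -(mulrA _ a a) aa.
by rewrite !(mul0r, mulr0, addr0, add0r).
Qed.

Let lifty v : lift (sl_y * v) = b * lift v.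
Proof.
have ba : b * a = e 'X - a * b by rewrite -ab addrC addKr.
case: v => c d f g; rewrite /lift /env_lift /=.
rewrite !(mul0r, mulr0, mul1r, addr0, add0r, subr0, sub0r) !mulrDr.
rewrite eb !mulrA !eb -!mulrA bb (mulrA b a b) ba mulrBl -(mulrA a b b) bb.
rewrite rmorphN rmorphD !rmorphM rmorph0 mulrBr !mulr0 subr0 mul0r !addr0.
rewrite mulrDl -!rmorphM [_ * d]mulrC mulNr !mulrA -!rmorphM [_ * g]mulrC.
by rewrite -!addrA addrCA; congr (_ + (_ + _)); rewrite addrC.
Qed.

Lemma env_liftM : {morph lift : u v / u * v}.
Proof.
move=> u v; rewrite {1}[u]env_expand !mulrDl -!mulrA !env_liftD.
by rewrite !liftU !liftx !lifty.
Qed.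

End LiftMorphism.


Lemma Usl11_universal (A : algType F) (rho : {linear 'M[F]_2 -> A}) :
  2%:R != 0 :> F -> super_morphism rho ->
  exists2 phi : {lrmorphism U -> A},
    forall X, sl11 X -> phi (sl11_inj X) = rho X &
    forall psi : {lrmorphism U -> A},
      (forall X, sl11 X -> psi (sl11_inj X) = rho X) -> psi =1 phi.
Proof.
move=> two_neq0 rhoS.
pose a := rho (delta_mx 0 1); pose b := rho (delta_mx 1 0); pose h := rho 1.
have sx : sl11 (delta_mx 0 1) by rewrite /sl11 !mxE subr0.
have sy : sl11 (delta_mx 1 0) by rewrite /sl11 !mxE subr0.
have sh : sl11 1 by rewrite /sl11 !mxE subrr.
have px : homogeneous true (delta_mx 0 1).
  by move=> [[|[|?]] ?] [[|[|?]] ?] //; rewrite mxE.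
have py : homogeneous true (delta_mx 1 0).
  by move=> [[|[|?]] ?] [[|[|?]] ?] //; rewrite mxE.
have half0 (z : A) : z + z = 0 -> z = 0.
  rewrite -mulr2n => zz; rewrite -[z]scale1r -(mulVf two_neq0) -scalerA.
  by rewrite scaler_nat zz scaler0.
have odd2 (B : algType F) (c d : B) : sbracket true true c d = c * d + d * c.
  by rewrite /sbracket expr1 mulN1r opprK.
have aa : a * a = 0.
  apply: half0; rewrite -odd2 -rhoS // odd2 -mulmxE mul_delta_mx_0 //.
  by rewrite addr0 linear0.
have bb : b * b = 0.
  apply: half0; rewrite -odd2 -rhoS // odd2 -mulmxE mul_delta_mx_0 //.
  by rewrite addr0 linear0.
have ab : a * b + b * a = h.
  rewrite -odd2 -rhoS // odd2 -mulmxE !mul_delta_mx; congr (rho _).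
  by apply/matrixP => [[[|[|?]] ?] [[|[|?]] ?]]; rewrite !mxE //= ?addr0 ?add0r.
have ha : a * h = h * a.
  by rewrite -ab mulrDr mulrDl mulrA aa mul0r add0r -(mulrA b) aa mulr0 addr0 mulrA.
have hb : b * h = h * b.
  by rewrite -ab mulrDr mulrDl -(mulrA a) mulrA mulrA bb mul0r addr0 mulr0 add0r.
have [e eX eC] : exists2 e : {rmorphism {poly F} -> A},
    e 'X = h & forall k, e k%:P = k%:A.
  exists (GRing.RMorphism.clone _ _ (horner_alg h) _).
    exact: horner_algX.
  exact: horner_algC.
have comm (c : A) : c * h = h * c -> forall p, c * e p = e p * c.
  move=> ch; elim/poly_ind => [|p k IH]; first by rewrite rmorph0 mulr0 mul0r.
  rewrite rmorphD rmorphM eX mulrDr mulrDl mulrA IH -!mulrA ch.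
  by rewrite eC mulr_algl mulr_algr.
pose phi := env_lift e a b.
rewrite -eX in ab.
have phiZ k u : phi (k *: u) = k *: phi u.
  have eZ p : e (k *: p) = k *: e p by rewrite -mul_polyC rmorphM eC mulr_algl.
  by rewrite /phi /env_lift /= !eZ !scalerDr !scalerAl.
have phiD : {morph phi : u v / u + v} := env_liftD e a b.
have phiL : linear phi by move=> k u v; rewrite phiD phiZ.
have phiM : monoid_morphism phi.
  split; first exact: env_lift1.
  exact: (env_liftM aa bb ab (comm _ ha) (comm _ hb)).
pose L := GRing.isLinear.Build F U A _ phi phiL.
pose M := GRing.isMonoidMorphism.Build U A phi phiM.
have [Phi PhiK] : exists Phi : {lrmorphism U -> A}, Phi =1 phi.
  by pose Phi : {lrmorphism U -> A} := HB.pack phi L M; exists Phi.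
have rhoE X : sl11 X -> rho X = X 0 0 *: h + X 0 1 *: a + X 1 0 *: b.
  move=> /subr0_eq X01; rewrite -!linearZ -!linearD; congr (rho _).
  have o2 (i : 'I_2) : i = 0 \/ i = 1.
    by case: i => [[|[|?]] ?] //; [left | right]; apply: val_inj.
  apply/matrixP => i j; rewrite !mxE.
  by case: (o2 i) => ->; case: (o2 j) => -> /=;
    rewrite -?X01 !(mulr0, mulr1, addr0, add0r).
have Phix : Phi sl_x = a.
  by rewrite PhiK /phi /env_lift /= rmorph0 rmorph1 !mul0r mul1r !addr0 add0r.
have Phiy : Phi sl_y = b.
  by rewrite PhiK /phi /env_lift /= rmorph0 rmorph1 !mul0r mul1r !addr0 !add0r.
have Phih : Phi sl_h = h.
  by rewrite PhiK /phi /env_lift /= rmorph0 !mul0r !addr0.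
have PhiE X : sl11 X -> Phi (sl11_inj X) = rho X.
  by move=> hX; rewrite rhoE // /sl11_inj !linearD !linearZ /= Phix Phiy Phih.
exists Phi => // psi psiE u.
have inj_x : sl11_inj (delta_mx 0 1) = sl_x.
  by rewrite /sl11_inj !mxE /= !scale0r scale1r addr0 add0r.
have inj_y : sl11_inj (delta_mx 1 0) = sl_y.
  by rewrite /sl11_inj !mxE /= !scale0r scale1r !add0r.
have inj_h : sl11_inj 1 = sl_h.
  by rewrite /sl11_inj !mxE /= !scale0r scale1r !addr0.
have psix : psi sl_x = Phi sl_x by rewrite Phix -inj_x psiE.
have psiy : psi sl_y = Phi sl_y by rewrite Phiy -inj_y psiE.
have psih : psi sl_h = Phi sl_h by rewrite Phih -inj_h psiE.
have psiU p : psi (Uh p) = Phi (Uh p).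
  elim/poly_ind: p => [|p k IH]; first by rewrite !rmorph0.
  have -> : Uh (p * 'X + k%:P) = Uh p * sl_h + k *: 1.
    by apply: env_eq; rewrite /= ?(mulr0, mul0r, subr0, addr0, scaler0) // alg_polyC.
  rewrite !rmorphD !rmorphM; congr (_ * _ + _) => //.
  by rewrite [LHS](rmorph_alg psi) [RHS](rmorph_alg Phi).
rewrite [u]env_expand !(rmorphD, rmorphM).
by congr (_ + _ * _ + _ * _ + _ * (_ * _)); first [exact: psiU | done].
Qed.

End Enveloping.

(* M is an object of the category of U(sl(1|1))-modules that are free of
   rank n over U(h). *)
Definition in_M_sl11 (F : fieldType) (n : nat) (M : lmodType (Usl11 F)) :
  Prop := free_of_rank (restrict M (@Uh F)) n.

Definition sl11_rel (F : fieldType) (P Q : 'M[{poly F}]_2) : Prop :=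
  [/\ P *m P = 0, Q *m Q = 0 & P *m Q + Q *m P = 'X%:M].

Section MatrixModules.
Variables (F : fieldType) (P Q : 'M[{poly F}]_2) (PQ : sl11_rel P Q).

Definition MPQ (_ : sl11_rel P Q) : Type := 'cV[{poly F}]_2.

HB.instance Definition _ := GRing.Zmodule.on (MPQ PQ).

Definition env_mx : Usl11 F -> 'M[{poly F}]_2 := env_lift scalar_mx P Q.

Definition MPQ_scale (u : Usl11 F) (v : MPQ PQ) : MPQ PQ :=
  env_mx u *m (v : 'cV_2).

Fact MPQ_scaleA u v m : MPQ_scale u (MPQ_scale v m) = MPQ_scale (u * v) m.
Proof.
rewrite /MPQ_scale mulmxA; congr (_ *m _); case: PQ => PP QQ PQh.
rewrite mulmxE /env_mx (env_liftM (e := scalar_mx)) //.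
- by move=> p; rewrite -!mulmxE scalar_mxC.
- by move=> p; rewrite -!mulmxE scalar_mxC.
Qed.
Fact MPQ_scale1 : left_id 1 MPQ_scale.
Proof. by move=> m; rewrite /MPQ_scale /env_mx env_lift1 mul1mx. Qed.
Fact MPQ_scaleDr : right_distributive MPQ_scale +%R.
Proof. by move=> u m n; rewrite /MPQ_scale -mulmxDr. Qed.
Fact MPQ_scaleDl m : {morph MPQ_scale^~ m : u v / u + v}.
Proof. by move=> u v; rewrite /MPQ_scale -mulmxDl /env_mx env_liftD. Qed.

HB.instance Definition _ := GRing.Zmodule_isLmodule.Build (Usl11 F) (MPQ PQ)
  MPQ_scaleA MPQ_scale1 MPQ_scaleDr MPQ_scaleDl.

Lemma MPQ_Uh (p : {poly F}) (v : MPQ PQ) : Uh p *: v = p *: (v : 'cV_2).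
Proof.
rewrite [LHS]/GRing.scale /= /MPQ_scale /env_mx /env_lift /=.
by rewrite !raddf0 !mul0r !addr0 mul_scalar_mx.
Qed.

Lemma MPQ_x (v : MPQ PQ) : sl_x F *: v = P *m (v : 'cV_2).
Proof.
rewrite [LHS]/GRing.scale /= /MPQ_scale /env_mx /env_lift /=.
by rewrite !raddf0 !mul0r !addr0 add0r mul1r.
Qed.

Lemma MPQ_y (v : MPQ PQ) : sl_y F *: v = Q *m (v : 'cV_2).
Proof.
rewrite [LHS]/GRing.scale /= /MPQ_scale /env_mx /env_lift /=.
by rewrite !raddf0 !mul0r !addr0 !add0r mul1r.
Qed.

Lemma MPQ_in_M_sl11 : in_M_sl11 2 (MPQ PQ).
Proof.
pose e (i : 'I_2) : restrict (MPQ PQ) (@Uh F) := (delta_mx i 0 : 'cV_2).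
have sumE (c : {ffun 'I_2 -> {poly F}}) :
    \sum_(i < 2) c i *: e i = (\col_i c i : 'cV_2).
  have scE p (v : restrict (MPQ PQ) (@Uh F)) : p *: v = p *: (v : 'cV_2).
    exact: MPQ_Uh.
  rewrite !big_ord_recl big_ord0 addr0 !scE.
  apply/matrixP => [[[|[|?]] ?] j]; rewrite !mxE ord1 /= ?mulr1 ?mulr0 //;
    rewrite ?addr0 ?add0r; congr (c _); exact: val_inj.
exists e => m; exists [ffun i => (m : 'cV_2) i 0]; split.
  by rewrite sumE; apply/matrixP => i j; rewrite ord1 !mxE ffunE.
by move=> c ->; rewrite sumE; apply/ffunP => i; rewrite ffunE mxE.
Qed.

End MatrixModules.

Arguments MPQ {F} P Q _.

Definition mx22 (R : Type) (a b c d : R) : 'M[R]_2 :=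
  \matrix_(i, j) if i == 0 then (if j == 0 then a else b)
                 else (if j == 0 then c else d).

Section TwoModules.
Variable F : fieldType.

Let mx22M (a b c d a' b' c' d' : {poly F}) :
  mx22 a b c d *m mx22 a' b' c' d' =
  mx22 (a * a' + b * c') (a * b' + b * d') (c * a' + d * c') (c * b' + d * d').
Proof.
by apply/matrixP => i j; rewrite !mxE !big_ord_recl big_ord0 addr0 !mxE /=;
  case: (i == 0); case: (j == 0).
Qed.

Let mx22_0 : mx22 0 0 0 0 = 0 :> 'M[{poly F}]_2.
Proof. by apply/matrixP => i j; rewrite !mxE; do 2?case: ifP. Qed.

Let mx22_h : mx22 'X 0 0 0 + mx22 0 0 0 'X = 'X%:M :> 'M[{poly F}]_2.
Proof.
by apply/matrixP => [[[|[|?]] ?] [[|[|?]] ?]]; rewrite !mxE //= ?addr0 ?add0r.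
Qed.

Lemma rel_1h : sl11_rel (mx22 0 1 0 0) (mx22 0 0 'X 0 : 'M[{poly F}]_2).
Proof.
by split; rewrite !mx22M !(mul0r, mulr0, mul1r, mulr1, addr0, add0r) ?mx22_h.
Qed.

Lemma rel_h1 : sl11_rel (mx22 0 'X 0 0) (mx22 0 0 1 0 : 'M[{poly F}]_2).
Proof.
by split; rewrite !mx22M !(mul0r, mulr0, mul1r, mulr1, addr0, add0r) ?mx22_h.
Qed.


End TwoModules.

Definition ideal_sum (A : Type) (J K : set A) : set 'cV[A]_2 :=
  [set v | J (v 0 0) /\ K (v 1 0)].

Definition hmul (F : fieldType) (J : set {poly F}) : set {poly F} :=
  [set 'X * f | f in J].

(* Main.v *)
Require Import Defs.
From mathcomp Require Import all_boot all_order all_algebra.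
From mathcomp Require Import complex ring.
From mathcomp Require Import boolp classical_sets reals.
Import GRing.Theory.
Local Open Scope ring_scope.
Local Open Scope classical_set_scope.

(** The element [h] is central, acts injectively on a module which is free over
    [F[h]], and not surjectively as soon as the rank is positive; hence
    [M > hM > h^2 M > ...] is strictly decreasing and [M] has infinite length.

    For the two explicit modules, order the entries so that [x] and [y] act as
    [(f, g) -> (g, 0)] and [(f, g) -> (0, hf)], in some order, and let [J] and
    [K] be the projections of a submodule [N] onto the two entries.  Then
    [hJ <= K <= J], and [J] being principal forces [K = J] or [K = hJ].  In the
    first case [N] contains [K + 0 = J + 0], in the second one it contains
    [0 + hJ = 0 + K]; either way [N] is the sum of its two projections. *)

Lemma submoduleP (A : nzRingType) (M : lmodType A) (N : set M) :
  is_submodule N <->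
  N 0 /\ forall a u v, N u -> N v -> N (a *: u + v).
Proof.
split=> [[N0 NL]|[N0 NL]]; split.
- by move: N0; rewrite inE.
- by move=> a u v Nu Nv; have := NL a u v; rewrite !inE; apply.
- by rewrite inE.
- by move=> a u v; rewrite !inE; apply: NL.
Qed.

(** Centrality makes the image of each [c ^+ k] a submodule, and injectivity cancels [c ^+ k]: if
    [m] is not a multiple of [c], then [c ^+ k *: m] is not a multiple of [c ^+ k.+1]. *)
Lemma infinite_length_central (A : nzRingType) (M : lmodType A) (c : A) :
  (forall a, GRing.comm c a) -> injective (fun m : M => c *: m) ->
  (exists m : M, forall m', m <> c *: m') -> infinite_length M.
Proof.
move=> cC cI [m mN] [l /(_ l.+1)]; rewrite ltnn => H.
suff /H : has_chain M l.+1 by [].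
(* Chains are increasing, so the exponent runs down from [l.+1] to 0; this gives [l.+1] strict
   steps, one more than the bound [l] allows. *)
exists (fun i => range (fun v : M => c ^+ (l.+1 - i) *: v)); split=> i il.
  apply/submoduleP; split; first by exists 0; rewrite ?scaler0.
  move=> a _ _ [u _ <-] [v _ <-]; exists (a *: u + v) => //.
  have ca : GRing.comm a (c ^+ (l.+1 - i)) by apply/commrX/commr_sym.
  by rewrite scalerDr !scalerA ca.
rewrite -(subnSK il) subSS; move: (l - i)%N => k; split.
  by move=> _ [v _ <-]; exists (c *: v); rewrite // scalerA -exprSr.
move/(_ (c ^+ k *: m)) => /(_ (ex_intro2 _ _ m I erefl)) [v _].
have {}cI : injective (fun w : M => c ^+ k *: w).
  elim: k => [|k IH] w w'; first by rewrite !scale1r.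
  by rewrite exprS -!scalerA => /cI/IH.
by rewrite exprSr -scalerA => /cI/esym/mN.
Qed.

Lemma free_scale_inj (A : idomainType) (L : lmodType A) n (a : A) :
  a != 0 -> free_of_rank L n -> injective (fun m : L => a *: m).
Proof.
move=> aN0 [e eP] u v /eqP; rewrite -subr_eq0 -scalerBr => /eqP a0.
apply/eqP; rewrite -subr_eq0; apply/eqP; move: (u - v) a0 => m.
have [c [-> _]] := eP m; rewrite scaler_sumr => c0.
have [c' [_ c'U]] := eP 0.
(* Both families are coordinates of 0, so uniqueness identifies them. *)
have ac0 : [ffun i => a * c i] = [ffun=> 0].
  rewrite -(c'U [ffun i => a * c i]); last first.
    by rewrite -[LHS]c0; apply: eq_bigr => i _; rewrite ffunE scalerA.
  by apply: c'U; rewrite big1 // => i _; rewrite ffunE scale0r.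
apply: big1 => i _; move/ffunP/(_ i)/eqP: ac0.
by rewrite !ffunE mulf_eq0 (negPf aN0) => /eqP ->; rewrite scale0r.
Qed.

(** If a basis vector were [a *: m], comparing its own coordinate would give [1 = a * c ord0],
    making [a] a unit. *)
Lemma free_scale_nonsurj (A : comUnitRingType) (L : lmodType A) n (a : A) :
  a \isn't a GRing.unit -> free_of_rank L n.+1 ->
  exists m : L, forall m', m <> a *: m'.
Proof.
move=> /unitrPr aU [e eP]; exists (e ord0) => m em; apply: aU.
have [c [mE _]] := eP m; have [d [_ dU]] := eP (e ord0).
have dE : d = [ffun i => (i == ord0)%:R].
  apply: dU; rewrite (bigD1 ord0) //= big1 => [|i /negPf i0]; last first.
    by rewrite ffunE i0 scale0r.
  by rewrite ffunE eqxx scale1r addr0.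
have {}dU : d = [ffun i => a * c i].
  apply: dU; rewrite em mE scaler_sumr.
  by apply: eq_bigr => i _; rewrite ffunE scalerA.
by exists (c ord0); move/ffunP/(_ ord0): dU; rewrite dE !ffunE.
Qed.

Section Modules.
Variable F : fieldType.

Lemma Uh_X_central (u : Usl11 F) : GRing.comm (Uh 'X) u.
Proof.
case: u => a b c d; rewrite /GRing.comm; apply: env_eq => /=; ring.
Qed.

Lemma in_M_infinite_length n (M : lmodType (Usl11 F)) :
  in_M_sl11 n.+1 M -> infinite_length M.
Proof.
move=> freeM; apply: (@infinite_length_central _ _ (Uh 'X)).
- exact: Uh_X_central.
(* In the restriction along [Uh], scaling by ['X] is by definition scaling by [Uh 'X]. *)
- exact: (free_scale_inj _ _ _ _ (negbT (polyX_eq0 _)) freeM).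
- apply: (free_scale_nonsurj _ _ _ 'X _ freeM).
  by rewrite poly_unitE size_polyX.
Qed.

(** Euclidean division by a nonzero element of least size; the zero ideal takes [d = 0]. *)
Lemma poly_ideal_principal (J : set {poly F}) :
  is_ideal J -> exists2 d, J d & forall f, J f -> exists q, f = q * d.
Proof.
move=> /submoduleP[J0 JL].
have [[f0 [Jf0 f0N0]]|Jtriv] := pselect (exists f, J f /\ f != 0); last first.
  exists 0 => // f Jf; exists 0; rewrite mul0r; apply/eqP.
  by apply: contrapT => /negP f0; apply: Jtriv; exists f.
pose P n := `[< exists2 f, J f /\ f != 0 & size f = n >].
have exP : exists n, P n by exists (size f0); apply/asboolP; exists f0.
case: (ex_minnP exP) => _ /asboolP[d [Jd dN0] <-] dmin.
exists d => // f Jf; exists (f %/ d)%R.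
have /eqP : (f %% d)%R = 0.
  apply/eqP; apply: contraT => rN0.
  have := ltn_modp f d; rewrite dN0 ltnNge dmin //.
  apply/asboolP; exists (f %% d)%R => //; split=> //.
  have -> : (f %% d)%R = - (f %/ d)%R * d + f.
    by rewrite {3}(divp_eq f d) mulNr addKr.
  exact: JL.
by rewrite -/(d %| f)%R dvdp_eq => /eqP.
Qed.

(** If [d] generates [J], its class spans [J / hJ] over [F], a space of dimension at most 1, so
    nothing lies strictly between [hJ] and [J]. *)
Lemma ideal_between (J K : set {poly F}) :
  is_ideal J -> is_ideal K -> hmul J `<=` K -> K `<=` J ->
  K = J \/ K = hmul J.
Proof.
move=> iJ /submoduleP[_ KL] hJK KJ.
have [d Jd dgen] := poly_ideal_principal J iJ.
have /submoduleP[J0 JL] := iJ.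
have JM a f : J f -> J (a * f) by move=> Jf; rewrite -[_ * _]addr0; exact: JL.
have K0 : K 0 by apply: hJK; exists 0; rewrite ?mulr0.
have [KhJ|/existsNP[g /not_implyP[Kg gN]]] := pselect (K `<=` hmul J).
  by right; apply/seteqP; split.
left; apply/seteqP; split=> //.
suff Kd : K d.
  by move=> f /dgen[q ->]; rewrite -[_ * _]addr0; exact: KL.
have [q gE] := dgen g (KJ g Kg).
have [r [c qE]] : exists r c, q = r * 'X + c%:P.
  elim/poly_ind: q {gE} => [|r c _]; last by exists r, c.
  by exists 0, 0; rewrite mul0r addr0.
have [c0|cN0] := eqVneq c 0.
  case: gN; exists (r * d); first exact: JM.
  by rewrite gE qE c0 addr0 mulrA (mulrC 'X).
(* From [g = (r * 'X + c) * d] with [c] invertible, solve for [d]; the term ['X * (r * d)] lies in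
   [hJ], hence in [K]. *)
have -> : d = (c^-1)%:P *: (g : {poly F}^o) +
    (- (c^-1)%:P *: ('X * (r * d) : {poly F}^o) + 0).
  rewrite addr0 /GRing.scale /= mulNr -mulrBr gE qE mulrDl mulrA (mulrC 'X).
  by rewrite addrC addKr mulrA -polyCM mulVf // mul1r.
apply: (KL) => //; apply: KL => //; apply: hJK; exists (r * d) => //.
exact: JM.
Qed.

(** The indices stay abstract to cover both modules: [(i, j)] is [(0, 1)] for the first and [(1, 0)]
    for the second, where [x] and [y] exchange roles. *)
Lemma submodule_shape (N : set 'cV[{poly F}]_2) (i j : 'I_2) : i != j ->
  is_submodule N ->
  (forall v, N v -> N (v j 0 *: delta_mx i 0)) ->
  (forall v, N v -> N (('X * v i 0) *: delta_mx j 0)) ->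
  exists2 J : set {poly F}, is_ideal J &
    N = [set v | J (v i 0) /\ J (v j 0)] \/
    N = [set v | J (v i 0) /\ hmul J (v j 0)].
Proof.
move=> ij /submoduleP[N0 NL] Nx Ny.
have proj_ideal k : is_ideal [set f | exists2 v, N v & v k 0 = f].
  apply/submoduleP; split; first by exists 0; rewrite ?mxE.
  move=> a _ _ [u Nu <-] [v Nv <-]; exists (a *: u + v); rewrite ?mxE //.
  exact: NL.
have vE (v : 'cV[{poly F}]_2) :
    v = v i 0 *: delta_mx i 0 + v j 0 *: delta_mx j 0.
  apply/colP => k; rewrite !mxE !eqxx !andbT.
  have [->|ki] := eqVneq k i; first by rewrite (negPf ij) mulr1 mulr0 addr0.
  have -> : k = j.
    move: ki ij; clear.
    case: i j k => [[|[|?]] ?] [[|[|?]] ?] [[|[|?]] ?] // _ _; exact: val_inj.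
  by rewrite eqxx mulr0 mulr1 add0r.
have NB u v : N u -> N v -> N (u - v).
  by move=> Nu Nv; rewrite addrC -scaleN1r; exact: NL.
have ND u v : N u -> N v -> N (u + v).
  by move=> Nu Nv; rewrite -[u]scale1r; exact: NL.
pose J := [set f | exists2 v, N v & v i 0 = f].
pose K := [set f | exists2 v, N v & v j 0 = f].
have hJK : hmul J `<=` K.
  move=> _ [_ [v Nv <-] <-]; exists (('X * v i 0) *: delta_mx j 0).
    exact: Ny.
  by rewrite !mxE !eqxx mulr1.
have KJ : K `<=` J.
  move=> _ [v Nv <-]; exists (v j 0 *: delta_mx i 0); first exact: Nx.
  by rewrite !mxE !eqxx mulr1.
exists J; first exact: proj_ideal.
have [KE|KE] := ideal_between J K (proj_ideal i) (proj_ideal j) hJK KJ.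
(* Each [f] in [J = K] is the [j] entry of some vector of [N], which [Nx] moves to entry [i].
   Subtracting such vectors isolates the [j] entries. *)
- have NJ f : J f -> N (f *: delta_mx i 0).
    by rewrite -KE => -[v Nv <-]; exact: Nx.
  left; apply/seteqP; split=> v /= => [Nv|[Ji]].
    by split; [exists v | rewrite -KE; exists v].
  rewrite -KE => -[w Nw wj].
  rewrite (vE v) -wj; apply: ND; first exact: NJ.
  have -> : w j 0 *: delta_mx j 0 = w - w i 0 *: delta_mx i 0.
    by rewrite {2}(vE w) addrC addKr.
  by apply: NB => //; apply: NJ; exists w.
(* Here [f] is ['X] times the [i] entry of some vector of [N], so [Ny] applies instead. *)
- have NK f : K f -> N (f *: delta_mx j 0).
    by rewrite KE => -[_ [v Nv <-] <-]; exact: Ny.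
  right; apply/seteqP; split=> v /= => [Nv|[[w Nw wi]]].
    by split; [exists v | rewrite -KE; exists v].
  rewrite -KE => Kj; rewrite (vE v) -wi; apply: ND; last exact: NK.
  have -> : w i 0 *: delta_mx i 0 = w - w j 0 *: delta_mx j 0.
    by rewrite {2}(vE w) addrK.
  by apply: NB => //; apply: NK; exists w.
Qed.

Lemma mx22_antidiag_mul (a b : {poly F}) (v : 'cV[{poly F}]_2) :
  mx22 0 a 0 0 *m v = (a * v 1 0) *: delta_mx 0 0 /\
  mx22 0 0 b 0 *m v = (b * v 0 0) *: delta_mx 1 0.
Proof.
by split; apply/colP => -[[|[|?]] ?] //;
  rewrite !mxE !big_ord_recl big_ord0 !mxE /=
    !(mul0r, mulr0, mulr1, add0r, addr0) //;
  congr (_ * v _ _); exact: val_inj.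
Qed.

(** Passes from the enveloping algebra to column vectors over [F[h]], the setting of
    [submodule_shape]. *)
Lemma MPQ_submodule_shape (P Q : 'M[{poly F}]_2) (PQ : sl11_rel P Q)
    (N : set (MPQ P Q PQ)) :
  is_submodule N ->
  [/\ @is_submodule _ 'cV[{poly F}]_2 N,
      forall v : 'cV_2, N v -> N (P *m v) &
      forall v : 'cV_2, N v -> N (Q *m v)].
Proof.
move=> /submoduleP[N0 NL]; split.
- by apply/submoduleP; split=> // a u v; rewrite -(@MPQ_Uh _ _ _ PQ); exact: NL.
- by move=> v Nv; rewrite -(@MPQ_x _ _ _ PQ) -[_ *: _]addr0; exact: NL.
- by move=> v Nv; rewrite -(@MPQ_y _ _ _ PQ) -[_ *: _]addr0; exact: NL.
Qed.

End Modules.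

Theorem proposition3p3 (R : realType) :
  (forall M : lmodType (Usl11 R[i]), in_M_sl11 2 M -> infinite_length M) /\
  (forall N : set (MPQ (mx22 0 1 0 0) (mx22 0 0 'X 0) (rel_1h R[i])),
     is_submodule N ->
     exists2 J : set {poly R[i]}, is_ideal J &
       N = ideal_sum J J \/ N = ideal_sum J (hmul J)) /\
  (forall N : set (MPQ (mx22 0 'X 0 0) (mx22 0 0 1 0) (rel_h1 R[i])),
     is_submodule N ->
     exists2 J : set {poly R[i]}, is_ideal J &
       N = ideal_sum J J \/ N = ideal_sum (hmul J) J).
Proof.
split; first by move=> M; exact: in_M_infinite_length.
split=> N /MPQ_submodule_shape[Nsub Nx Ny].
- apply: (submodule_shape _ N 0 1) => // v Nv.
  + by have := Nx v Nv; rewrite (mx22_antidiag_mul _ 1 1 v).1 mul1r.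
  + by have := Ny v Nv; rewrite (mx22_antidiag_mul _ 1 'X v).2.
- have [||v Nv|v Nv|J iJ NE] := submodule_shape _ N 1 0 => //.
  + by have := Ny v Nv; rewrite (mx22_antidiag_mul _ 1 1 v).2 mul1r.
  + by have := Nx v Nv; rewrite (mx22_antidiag_mul _ 'X 1 v).1.
  (* With [i = 1] the condition on the second entry comes first, so the conjunction is swapped. *)
  + exists J => //; case: NE => ->; [left|right]; exact: setIC.
Qed.
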